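(* Let $\phi(\bar v)$ be an $\mathrm{FO}(\perp\!\!\!\perp_c,\sim)[\tau]$-formula whose free variables are among $\bar v=(v_1,\dots,v_k)$. Then there is a formula $\psi_\phi(f)\in\mathrm{SO}_{d[0,1]}(\mathrm{SUM},\times)$ with exactly one free function variable $f$ ($k$-ary) such that for all finite $\tau$-structures $\mathcal A$ and all probabilistic teams $\mathbb X\colon X\to[0,1]$ over $\{v_1,\dots,v_k\}$: $\mathcal A\models_{\mathbb X}\phi(\bar v)$ iff $(\mathcal A,f_{\mathbb X})\models\psi_\phi(f)$, where $f_{\mathbb X}\colon A^k\to[0,1]$ is the probability distribution with $f_{\mathbb X}(s(\bar v))=\mathbb X(s)$ for all $s\in X$ (and $0$ elsewhere).
   Context: Probabilistic team semantics. Fix a finite relational vocabulary $\tau$ containing $=$; structures $\mathcal A$ are finite $\tau$-structures with universe $A$. An assignment over a finite set $D$ of first-order variables is a map $s\colon D\to A$; $s(a/x)$ maps $x$ to $a$ and agrees with $s$ elsewhere. A probabilistic team over $D$ is a function $\mathbb X\colon X\to[0,1]$ with $\sum_{s\in X}\mathbb X(s)=1$, where $X$ is a finite set of assignments over $D$ (zero weights allowed); $\mathrm{supp}(\mathbb X)=\{s:\mathbb X(s)\neq0\}$. For a tuple $\bar x$ and $\bar a\in A^{|\bar x|}$, $|\mathbb X_{\bar x=\bar a}|=\sum_{s\in X,\,s(\bar x)=\bar a}\mathbb X(s)$. For $F$ mapping each $t\in X$ to a probability distribution $F(t)$ on $A$, $\mathbb X(F/x)(s(a/x))=\sum_{t\in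 X,\ t(a/x)=s(a/x)}\mathbb X(t)\,F(t)(a)$; $\mathbb X(A/x)$ is $\mathbb X(F/x)$ with every $F(t)$ uniform on $A$. For $k\in[0,1]$, $\mathbb Y\sqcup_k\mathbb Z$ is $s\mapsto k\mathbb Y(s)+(1-k)\mathbb Z(s)$ (missing weights read as $0$). Syntax of $\mathrm{FO}(\perp\!\!\!\perp_c,\sim)$: $\phi::=R(\bar x)\mid\neg R(\bar x)\mid \bar y\perp\!\!\!\perp_{\bar x}\bar z\mid\sim\phi\mid\phi\wedge\phi\mid\phi\vee\phi\mid\exists x\phi\mid\forall x\phi$ with $R\in\tau$. Semantics: $R(\bar x)$ (resp. $\neg R(\bar x)$) holds in $\mathbb X$ iff every $s\in\mathrm{supp}(\mathbb X)$ satisfies it in the Tarskian sense; $\bar y\perp\!\!\!\perp_{\bar x}\bar z$ holds iff $|\mathbb X_{\bar x\bar y=s(\bar x\bar y)}|\cdot|\mathbb X_{\bar x\bar z=s(\bar x\bar z)}|=|\mathbb X_{\bar x\bar y\bar z=s(\bar x\bar y\bar z)}|\cdot|\mathbb X_{\bar x=s(\bar x)}|$ for all $s\colon\mathrm{Var}(\bar x\bar y\bar z)\to A$; $\sim\phi$ holds iff $\phi$ does not; $\wedge$ is classical; $\phi\vee\psi$ holds in $\mathbb X$ iff $\phi$ holds in $\mathbb Y$ and $\psi$ in $\mathbb Z$ for some $\mathbb Y,\mathbb Z,k$ with $\mathbb Y\sqcup_k\mathbb Z=\mathbb X$; $\exists x\phi$ holds in $\mathbb X$ iff $\phi$ holds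 in $\mathbb X(F/x)$ for some $F$; $\forall x\phi$ holds in $\mathbb X$ iff $\phi$ holds in $\mathbb X(A/x)$. $\mathrm{SO}_{d[0,1]}(\mathrm{SUM},\times)$: over $\mathbb R$-structures (finite $\tau$-structures expanded by functions $A^{\mathrm{Ar}(f)}\to\mathbb R$), numerical terms $i::=f(\bar x)\mid i\times i\mid\mathrm{SUM}_{\bar y}\,i$, where $\mathrm{SUM}_{\bar y}\,i$ under $s$ is $\sum_{\bar b\in A^{|\bar y|}}$ of $i$ under $s(\bar b/\bar y)$; formulas $i=j\mid\neg i=j\mid R(\bar x)\mid\neg R(\bar x)\mid\wedge\mid\vee\mid\exists x\mid\forall x\mid\exists f\mid\forall f$, with first-order quantifiers over $A$ and function quantifiers ranging over probability distributions on $A^{\mathrm{Ar}(f)}$. *)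

(* Defs.v *)
From HB Require Import structures.
From mathcomp Require Import all_boot all_order all_algebra.
From mathcomp Require Import finmap.
From mathcomp Require Import Rstruct.
From Stdlib Require Import Reals.

Set Implicit Arguments.
Unset Strict Implicit.
Unset Printing Implicit Defensive.
Import Order.TTheory GRing.Theory Num.Theory.
Local Open Scope fset_scope.
Local Open Scope ring_scope.

(* A finite relational vocabulary tau: relation symbols [Sym] with arities
   [ar].  The equality symbol of tau is treated as a built-in atom. *)

Section FOSyntax.
Variables (Sym : finType) (ar : Sym -> nat).

Inductive foform :=
  | FRel (r : Sym) (xs : (ar r).-tuple nat)
  | FNRel (r : Sym) (xs : (ar r).-tuple nat)
  | FEq (x y : nat)
  | FNEq (x y : nat)
  | FInd (xs ys zs : seq nat)                        (* ys _|_ _xs zs *)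
  | FTilde (phi : foform)
  | FAnd (phi psi : foform)
  | FOr (phi psi : foform)
  | FEx (x : nat) (phi : foform)
  | FAll (x : nat) (phi : foform).

Fixpoint fv (phi : foform) : seq nat :=
  match phi with
  | FRel _ xs => val xs
  | FNRel _ xs => val xs
  | FEq x y => [:: x; y]
  | FNEq x y => [:: x; y]
  | FInd xs ys zs => xs ++ ys ++ zs
  | FTilde p => fv p
  | FAnd p q => fv p ++ fv q
  | FOr p q => fv p ++ fv q
  | FEx x p => [seq y <- fv p | y != x]
  | FAll x p => [seq y <- fv p | y != x]
  end.

(* Function variables are pairs (name, arity). *)
Inductive soterm :=
  | TApp (f : nat * nat) (xs : f.2.-tuple nat)
  | TMul (i j : soterm)
  | TSum (ys : seq nat) (i : soterm).

Inductive soform :=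
  | SEqT (i j : soterm)
  | SNEqT (i j : soterm)
  | SRel (r : Sym) (xs : (ar r).-tuple nat)
  | SNRel (r : Sym) (xs : (ar r).-tuple nat)
  | SEqv (x y : nat)
  | SNEqv (x y : nat)
  | SAnd (p q : soform)
  | SOr (p q : soform)
  | SEx (x : nat) (p : soform)
  | SAll (x : nat) (p : soform)
  | SExF (f : nat * nat) (p : soform)
  | SAllF (f : nat * nat) (p : soform).

Fixpoint tfv (i : soterm) : seq nat :=
  match i with
  | TApp _ xs => val xs
  | TMul i j => tfv i ++ tfv j
  | TSum ys i => [seq y <- tfv i | y \notin ys]
  end.

Fixpoint sfv (p : soform) : seq nat :=
  match p with
  | SEqT i j => tfv i ++ tfv j
  | SNEqT i j => tfv i ++ tfv j
  | SRel _ xs => val xs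
  | SNRel _ xs => val xs
  | SEqv x y => [:: x; y]
  | SNEqv x y => [:: x; y]
  | SAnd p q => sfv p ++ sfv q
  | SOr p q => sfv p ++ sfv q
  | SEx x p => [seq y <- sfv p | y != x]
  | SAll x p => [seq y <- sfv p | y != x]
  | SExF _ p => sfv p
  | SAllF _ p => sfv p
  end.

Fixpoint tffv (i : soterm) : seq (nat * nat) :=
  match i with
  | TApp f _ => [:: f]
  | TMul i j => tffv i ++ tffv j
  | TSum _ i => tffv i
  end.

Fixpoint sffv (p : soform) : seq (nat * nat) :=
  match p with
  | SEqT i j => tffv i ++ tffv j
  | SNEqT i j => tffv i ++ tffv j
  | SRel _ _ => [::]
  | SNRel _ _ => [::]
  | SEqv _ _ => [::]
  | SNEqv _ _ => [::]
  | SAnd p q => sffv p ++ sffv q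
  | SOr p q => sffv p ++ sffv q
  | SEx _ p => sffv p
  | SAll _ p => sffv p
  | SExF f p => [seq h <- sffv p | h != f]
  | SAllF f p => [seq h <- sffv p | h != f]
  end.

End FOSyntax.

Section TeamSemantics.
Variables (Sym : finType) (ar : Sym -> nat).
Variables (A : finType) (I : forall r : Sym, {set (ar r).-tuple A}).

Definition asg (D : {fset nat}) := {ffun D -> A}.
(* a probabilistic team over D: weights on all assignments over D
   (assignments outside the team's set X simply carry weight 0) *)
Definition team (D : {fset nat}) := asg D -> R.

Definition is_prob (D : {fset nat}) (X : team D) :=
  (forall s, 0 <= X s) /\ \sum_(s : asg D) X s = 1.

Definition look (D : {fset nat}) (s : asg D) (y : nat) : option A :=
  omap s (insub y : option D).
Definition looks (D : {fset nat}) (s : asg D) (ys : seq nat) : seq (option A) :=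
  map (look s) ys.

Definition ext (D : {fset nat}) (t : asg D) (x : nat) (a : A) : asg (x |` D) :=
  [ffun v : (x |` D) => if fsval v == x then a else odflt a (look t (fsval v))].

Definition supd (D : {fset nat}) (X : team D) (F : asg D -> A -> R) (x : nat)
  : team (x |` D) :=
  fun s' => \sum_(t : asg D) \sum_(a : A) (if ext t x a == s' then X t * F t a else 0).

Arguments ext {D} t x a.
Arguments supd {D} X F x.

Definition mass (D : {fset nat}) (X : team D) (ys : seq nat) (target : seq (option A)) : R :=
  \sum_(s : asg D | looks s ys == target) X s.

Definition indep (D : {fset nat}) (X : team D) (xs ys zs : seq nat) : Prop :=
  forall u : asg D,
    mass X (xs ++ ys) (looks u (xs ++ ys)) * mass X (xs ++ zs) (looks u (xs ++ zs))
    = mass X (xs ++ ys ++ zs) (looks u (xs ++ ys ++ zs)) * mass X xs (looks u xs).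

Fixpoint sat (phi : foform ar) : forall D : {fset nat}, team D -> Prop :=
  match phi with
  | FRel r xs => fun D X => forall s, X s != 0 ->
      exists t : (ar r).-tuple A, looks s xs = map Some t /\ t \in I r
  | FNRel r xs => fun D X => forall s, X s != 0 ->
      exists t : (ar r).-tuple A, looks s xs = map Some t /\ t \notin I r
  | FEq x y => fun D X => forall s, X s != 0 ->
      exists a, look s x = Some a /\ look s y = Some a
  | FNEq x y => fun D X => forall s, X s != 0 ->
      exists a b, [/\ look s x = Some a, look s y = Some b & a != b]
  | FInd xs ys zs => fun D X => indep X xs ys zs
  | FTilde p => fun D X => ~ sat p X
  | FAnd p q => fun D X => sat p X /\ sat q X
  | FOr p q => fun D X => exists (Y Z : team D) (k : R),
      [/\ 0 <= k <= 1, is_prob Y, is_prob Z,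
          (forall s, X s = k * Y s + (1 - k) * Z s) & sat p Y /\ sat q Z]
  | FEx x p => fun D X => exists F : asg D -> A -> R,
      (forall t, (forall a, 0 <= F t a) /\ \sum_(a : A) F t a = 1) /\ sat p (supd X F x)
  | FAll x p => fun D X => sat p (supd X (fun _ _ => (#|A|%:R)^-1) x)
  end.

Definition updv (sigma : nat -> A) (x : nat) (a : A) : nat -> A :=
  fun y => if y == x then a else sigma y.

Definition upds (sigma : nat -> A) (ys : seq nat) (bs : seq A) : nat -> A :=
  fun y => if y \in ys then nth (sigma y) bs (index y ys) else sigma y.

Definition updF (env : nat * nat -> seq A -> R) (f : nat * nat)
  (g : {ffun f.2.-tuple A -> R}) : nat * nat -> seq A -> R :=
  fun h t => if h == f then
               match (insub t : option (f.2.-tuple A)) with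
               | Some tu => g tu | None => 0 end
             else env h t.

Arguments updF env f g : clear implicits.

Fixpoint teval (sigma : nat -> A) (env : nat * nat -> seq A -> R) (i : soterm) : R :=
  match i with
  | TApp f xs => env f (map sigma xs)
  | TMul i j => teval sigma env i * teval sigma env j
  | TSum ys i => \sum_(t : (size ys).-tuple A) teval (upds sigma ys t) env i
  end.

Fixpoint ssat (sigma : nat -> A) (env : nat * nat -> seq A -> R) (p : soform ar) : Prop :=
  match p with
  | SEqT i j => teval sigma env i = teval sigma env j
  | SNEqT i j => teval sigma env i <> teval sigma env j
  | SRel r xs => map_tuple sigma xs \in I r
  | SNRel r xs => map_tuple sigma xs \notin I r
  | SEqv x y => sigma x = sigma y
  | SNEqv x y => sigma x <> sigma y
  | SAnd p q => ssat sigma env p /\ ssat sigma env q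
  | SOr p q => ssat sigma env p \/ ssat sigma env q
  | SEx x p => exists a : A, ssat (updv sigma x a) env p
  | SAll x p => forall a : A, ssat (updv sigma x a) env p
  | SExF f p => exists g : {ffun f.2.-tuple A -> R},
      [/\ forall t, 0 <= g t, \sum_t g t = 1 & ssat sigma (updF env f g) p]
  | SAllF f p => forall g : {ffun f.2.-tuple A -> R},
      (forall t, 0 <= g t) -> \sum_t g t = 1 -> ssat sigma (updF env f g) p
  end.

Definition dom_of (vs : seq nat) : {fset nat} := [fset x | x in vs].

Definition fX (vs : seq nat) (X : team (dom_of vs)) (t : seq A) : R :=
  \sum_(s : asg (dom_of vs) | looks s vs == map Some t) X s.

Definition envX (vs : seq nat) (X : team (dom_of vs)) : nat * nat -> seq A -> R :=
  fun h t => if h == (O, size vs) then fX X t else 0.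

End TeamSemantics.

(* Main.v *)
Require Import Defs.
From HB Require Import structures.
From mathcomp Require Import all_boot all_order all_algebra.
From mathcomp Require Import finmap.
From mathcomp Require Import Rstruct.
From Stdlib Require Import Reals.
From Stdlib Require Import Classical FunctionalExtensionality.

(* A team over the variables [vs] is coded by a distribution on tuples of
   elements of [A], and each connective is translated separately.  The masses
   in an independence atom are marginal sums.  The connectives [exists x] and
   [forall x] quantify a distribution with the same marginal off [x], uniform
   in [x] for [forall x].  In a disjunction the mixing weight is read off an
   auxiliary joint distribution of a selector variable and an assignment, so
   neither addition nor real constants are needed.  The negation [~] becomes
   the dual formula. *)

Set Implicit Arguments.
Unset Strict Implicit.
Unset Printing Implicit Defensive.
Import Order.TTheory GRing.Theory Num.Theory.
Local Open Scope fset_scope.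
Local Open Scope ring_scope.

(** * Formulas of the translation *)

Section Translation.
Variables (Sym : finType) (ar : Sym -> nat).
Implicit Types (vs S : seq nat) (p q : soform ar).

(** Function variables range over distributions only, so a single number such as $1/|A|$ or a family
    of distributions such as a supplementing function $F$ cannot be quantified directly. Each is
    recovered from a joint distribution: $F$ is the conditional law of the new value given the other
    variables, and uniformity is invariance of the weights under changing that value. Because [~]
    may stand anywhere, every clause has to be an equivalence over all probabilistic teams; a
    one-sided encoding would not survive dualization. First-order valuations are total maps on names
    while the assignments of a team live on a finite domain, so the semantic lemmas speak of
    restrictions of total valuations. *)

Definition fresh vs := (foldr maxn 0 vs).+1.

Lemma fresh_notin vs : fresh vs \notin vs.
Proof.
suff le_max v : v \in vs -> (v <= foldr maxn 0 vs)%nat.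
  by apply/negP => /le_max; rewrite ltnn.
elim: vs => //= w vs IH; rewrite inE leq_max => /orP[/eqP->|/IH->].
  by rewrite leqnn.
by rewrite orbT.
Qed.

Definition fapp n vs : soterm := @TApp (n, size vs) (in_tuple vs).

(** [S] lists the variables that are kept. Only membership in [S] counts, which suits the
    concatenated lists of an independence atom, where variables may repeat. *)
Definition marg n vs S : soterm := TSum [seq v <- vs | v \notin S] (fapp n vs).

Definition alls vs p := foldr (@SAll _ ar) p vs.

(* A weight r of a distribution is 0 iff r * r = r and r <> 1; the term
   [marg n vs [::]] denotes the total weight 1. *)
Definition iszero n vs : soform ar :=
  SAnd (SEqT ar (TMul (fapp n vs) (fapp n vs)) (fapp n vs))
       (SNEqT ar (fapp n vs) (marg n vs [::])).

Fixpoint sneg p : soform ar :=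
  match p with
  | SEqT i j => SNEqT ar i j
  | SNEqT i j => SEqT ar i j
  | SRel r xs => SNRel xs
  | SNRel r xs => SRel xs
  | SEqv x y => SNEqv ar x y
  | SNEqv x y => SEqv ar x y
  | SAnd p q => SOr (sneg p) (sneg q)
  | SOr p q => SAnd (sneg p) (sneg q)
  | SEx x p => SAll x (sneg p)
  | SAll x p => SEx x (sneg p)
  | SExF f p => SAllF f (sneg p)
  | SAllF f p => SExF f (sneg p)
  end.

(** Quantifying [x] overwrites an old value of [x], so an earlier occurrence is dropped and the list
    stays duplicate-free. With [x] at the head, its new value is summed out over a tail. *)
Definition requant x vs := x :: [seq v <- vs | v != x].

Definition same_marg n vs x : soform ar :=
  let vs0 := [seq v <- vs | v != x] in
  alls vs0 (SEqT ar (marg n vs vs0) (marg n.+1 (requant x vs) vs0)).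

(** The lists [requant x vs] and [y :: vs0] have the same length, so both sides apply the same
    function variable; [y] plays a second, independent value of [x]. *)
Definition uniform_in n vs x : soform ar :=
  let vs0 := [seq v <- vs | v != x] in
  let y := fresh (requant x vs) in
  alls (y :: requant x vs)
    (SEqT ar (fapp n (requant x vs)) (fapp n (y :: vs0))).

(* Write f, g, h, w for the function variables named n, n+1, n+2, n+3: w is
   the joint law of a selector [y] and of an assignment drawn from g when
   [y = a] and from h otherwise, so f mixes g and h with weight P(y = a). *)
Definition mixture n vs y a : soform ar :=
  alls (y :: vs)
    (SAnd (SEqT ar (fapp n vs) (marg n.+3 (y :: vs) vs))
      (SOr
        (SAnd (SEqv ar y a)
          (SEqT ar (fapp n.+3 (y :: vs))
            (TMul (marg n.+3 (y :: vs) [:: y]) (fapp n.+1 vs))))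
        (SAnd (SNEqv ar y a)
          (SEqT ar (fapp n.+3 (y :: vs))
            (TMul (marg n.+3 (y :: vs) [:: y]) (fapp n.+2 vs)))))).

(* Team variables are reused as first-order variables of the translation,
   and the team over [vs] is the value of the function variable [(n, size vs)];
   every function variable bound by [tr n vs phi] has a name above [n]. *)
Fixpoint tr n vs (phi : foform ar) : soform ar :=
  match phi with
  | FRel r xs => alls vs (SOr (iszero n vs) (SRel xs))
  | FNRel r xs => alls vs (SOr (iszero n vs) (SNRel xs))
  | FEq x y => alls vs (SOr (iszero n vs) (SEqv ar x y))
  | FNEq x y => alls vs (SOr (iszero n vs) (SNEqv ar x y))
  | FInd xs ys zs => alls vs (SEqT ar
      (TMul (marg n vs (xs ++ ys)) (marg n vs (xs ++ zs)))
      (TMul (marg n vs (xs ++ ys ++ zs)) (marg n vs xs)))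
  | FTilde p => sneg (tr n vs p)
  | FAnd p q => SAnd (tr n vs p) (tr n vs q)
  | FOr p q =>
      let y := fresh vs in let a := fresh (y :: vs) in
      SEx a (SExF (n.+1, size vs) (SExF (n.+2, size vs)
        (SExF (n.+3, size (y :: vs))
          (SAnd (mixture n vs y a) (SAnd (tr n.+1 vs p) (tr n.+2 vs q))))))
  | FEx x p =>
      SExF (n.+1, size (requant x vs))
        (SAnd (same_marg n vs x) (tr n.+1 (requant x vs) p))
  | FAll x p =>
      SExF (n.+1, size (requant x vs))
        (SAnd (same_marg n vs x)
          (SAnd (uniform_in n.+1 vs x) (tr n.+1 (requant x vs) p)))
  end.

(** * Free variables of the translated formulas *)

Lemma mem_sfv_alls vs p v : (v \in sfv (alls vs p)) = (v \in sfv p) && (v \notin vs).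
Proof.
elim: vs => [|w vs IH] /=; first by rewrite andbT.
by rewrite mem_filter IH inE negb_or andbCA.
Qed.

Lemma sffv_alls vs p : sffv (alls vs p) = sffv p.
Proof. by elim: vs. Qed.

Lemma sfv_sneg p : sfv (sneg p) = sfv p.
Proof. by elim: p => //= [p -> q ->|p -> q ->|x p ->|x p ->]. Qed.

Lemma sffv_sneg p : sffv (sneg p) = sffv p.
Proof. by elim: p => //= [p -> q ->|p -> q ->|x p ->|x p ->]. Qed.

Lemma mem_tfv_marg n vs S v : (v \in tfv (marg n vs S)) = (v \in S) && (v \in vs).
Proof. by rewrite /= !mem_filter; case: (v \in S); case: (v \in vs). Qed.

Lemma mem_sfv_iszero n vs v : v \in sfv (iszero n vs) -> v \in vs.
Proof. by rewrite /= !mem_cat mem_filter => /orP[/orP[]|/orP[|/andP[]]] // /orP[]. Qed.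

Lemma requant_uniq x vs : uniq vs -> uniq (requant x vs).
Proof. by move=> /= Uvs; rewrite mem_filter eqxx filter_uniq. Qed.

Lemma mem_requant x vs v : (v \in requant x vs) = (v == x) || (v \in vs).
Proof. by rewrite inE mem_filter; case: eqP. Qed.

Lemma alls_closed vs p : {subset sfv p <= vs} -> sfv (alls vs p) =i [::].
Proof.
by move=> sub v; rewrite mem_sfv_alls; apply/negP => /andP[v_in]; rewrite (sub _ v_in).
Qed.

Lemma sfv_mixture n vs y a : {subset sfv (mixture n vs y a) <= [:: a]}.
Proof.
move=> v; rewrite mem_sfv_alls => /andP[v_in v_notin].
move: v_in v_notin; cbn [sfv tfv]; rewrite !mem_cat !mem_tfv_marg /= !inE.
by case: (v == y); case: (v == a); case: (v \in vs).
Qed.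

Lemma sfv_same_marg n vs x : sfv (same_marg n vs x) =i [::].
Proof.
apply: alls_closed => v; cbn [sfv].
by rewrite mem_cat !mem_tfv_marg => /orP[] /andP[].
Qed.

Lemma sfv_uniform_in n vs x : sfv (uniform_in n vs x) =i [::].
Proof.
apply: alls_closed => v; rewrite [sfv _]/= !(mem_cat, mem_filter, inE).
by case: (v == x); case: (v \in vs); rewrite ?orbT ?orbF //= => ->.
Qed.

Lemma fv_requant (vphi vs : seq nat) x :
  {subset [seq v <- vphi | v != x] <= vs} -> {subset vphi <= requant x vs}.
Proof.
move=> sub v v_in; rewrite mem_requant; case: eqP => //= /eqP v_x.
by apply: sub; rewrite mem_filter v_x.
Qed.

Lemma sfv_tr n vs phi : {subset fv phi <= vs} -> sfv (tr n vs phi) =i [::].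
Proof.
have atom m (us : seq nat) q : {subset sfv q <= us} -> {subset sfv (SOr (iszero m us) q) <= us}.
  by move=> sub w; cbn [sfv]; rewrite mem_cat => /orP[/mem_sfv_iszero //|]; exact: sub.
elim: phi n vs =>
  [r xs|r xs|x y|x y|xs ys zs|p IH|p IHp q IHq|p IHp q IHq|x p IH|x p IH]
  n vs sub.
1-4: by apply: alls_closed; apply: atom.
- apply: alls_closed => v.
  by cbn [sfv tfv]; rewrite !(mem_cat, mem_tfv_marg) => /orP[] /orP[] /andP[].
- by move=> v /=; rewrite sfv_sneg IH.
- by move=> v /=; rewrite mem_cat IHp ?IHq // => w w_in; apply: sub;
    rewrite /= mem_cat w_in ?orbT.
- move=> v; rewrite [sfv _]/= mem_filter !mem_cat IHp ?IHq; first last.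
  1-2: by move=> w w_in; apply: sub; rewrite /= mem_cat w_in ?orbT.
  by rewrite !orbF; apply/negP => /andP[v_a /sfv_mixture]; rewrite inE (negbTE v_a).
- by move=> v /=; rewrite mem_cat sfv_same_marg IH //; exact: fv_requant.
- move=> v /=; rewrite !mem_cat sfv_same_marg sfv_uniform_in IH //.
  exact: fv_requant.
Qed.

(** Every clause really mentions its own distribution, through a zero test, a marginal or a mixture
    condition, which gives equality and not just inclusion. The bound function variables have larger
    names, so they cannot capture it even at equal arity. *)
Lemma sffv_tr n vs phi h : (h \in sffv (tr n vs phi)) = (h == (n, size vs)).
Proof.
elim: phi n vs h =>
  [r xs|r xs|x y|x y|xs ys zs|p IH|p IHp q IHq|p IHp q IHq|x p IH|x p IH]
  n vs h.
1-5: by rewrite sffv_alls /= !inE ?orbb ?orbF.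
- by rewrite /= sffv_sneg IH.
- by rewrite /= mem_cat IHp IHq orbb.
- have neq m k : ((n, size vs) == (m + n.+1, k)%nat) = false.
    apply/negP => /eqP[nE _]; have : (n < m + n.+1)%nat by rewrite leq_addl.
    by rewrite -nE ltnn.
  rewrite [sffv _]/= !mem_filter !mem_cat IHp IHq sffv_alls /= !inE.
  have [->|_] := eqVneq h (n, size vs).
    by rewrite (neq 0) (neq 1%nat) (neq 2).
  by do 3![case: (h == _) => //=]; rewrite ?andbF.
- rewrite [sffv _]/= mem_filter mem_cat IH sffv_alls /= !inE.
  have [->|_] := eqVneq h (n, size vs); last by case: (h == _).
  by rewrite orTb andbT; apply/eqP => -[/eqP]; rewrite ltn_eqF.
- rewrite [sffv _]/= mem_filter !mem_cat IH !sffv_alls /= !inE.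
  have [->|_] := eqVneq h (n, size vs); last by case: (h == _).
  by rewrite orTb andbT; apply/eqP => -[/eqP]; rewrite ltn_eqF.
Qed.

End Translation.

(** * Assignments as restrictions of total valuations *)

Section Assignments.
Variable A : finType.
Implicit Types (D : {fset nat}) (vs S : seq nat) (sg : nat -> A).

(** By [restr_override] every assignment is some [restr D sg]; the valuation given to [override]
    only fills in names outside [D]. *)
Definition restr D sg : asg A D := [ffun v : D => sg (fsval v)].

Definition override D (s : asg A D) sg : nat -> A :=
  fun y => odflt (sg y) (look s y).

Definition agree_off vs sg sg' := forall y, y \notin vs -> sg' y = sg y.

Lemma look_restr D sg v : v \in D -> look (restr D sg) v = Some (sg v).
Proof. by move=> vD; rewrite /look insubT /= ffunE. Qed.

Lemma looks_restr D sg S : {subset S <= D} ->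
  looks (restr D sg) S = map Some (map sg S).
Proof.
move=> sub; rewrite /looks -map_comp; apply/eq_in_map => v /sub vD.
exact: look_restr.
Qed.

Lemma restr_override D (s : asg A D) sg : restr D (override s sg) = s.
Proof. by apply/ffunP => v; rewrite ffunE /override /look valK. Qed.

Lemma restr_eqP D sg sg' :
  reflect {in D, sg =1 sg'} (restr D sg == restr D sg').
Proof.
apply: (iffP eqP) => [E v vD|E].
  by apply: Some_inj; rewrite -!(look_restr _ vD) E.
by apply/ffunP => v; rewrite !ffunE E // fsvalP.
Qed.

Lemma looks_eqP D S sg sg' : {subset S <= D} ->
  reflect {in S, sg =1 sg'} (looks (restr D sg) S == looks (restr D sg') S).
Proof.
move=> sub; rewrite !looks_restr //; apply: (iffP eqP) => [|E].
  by move/(inj_map (@Some_inj _))/eq_in_map.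
by congr map; apply/eq_in_map.
Qed.

Lemma ext_restr D sg x a :
  ext (restr D sg) x a = restr (x |` D) (updv sg x a).
Proof.
apply/ffunP => v; rewrite !ffunE /updv; case: eqP => // /eqP v_x.
have vD : fsval v \in D by move: (fsvalP v); rewrite !inE (negbTE v_x).
by rewrite look_restr.
Qed.

Lemma map_upds vs (t : seq A) sg : uniq vs -> size t = size vs ->
  map (upds sg vs t) vs = t.
Proof.
move=> Uvs szt; case: vs Uvs szt => [|v vs] Uvs szt; first by case: t szt.
apply: (@eq_from_nth _ (sg 0%nat)); rewrite size_map // => i lt_i.
rewrite (nth_map 0%nat) // /upds mem_nth // index_uniq //.
by apply: set_nth_default; rewrite szt.
Qed.

Lemma upds_off vs (t : seq A) sg : agree_off vs sg (upds sg vs t).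
Proof. by move=> y /negbTE y_vs; rewrite /upds y_vs. Qed.

Lemma upds1 y a sg : upds sg [:: y] [:: a] =1 updv sg y a.
Proof. by move=> v; rewrite /upds /updv inE; case: eqP => //= ->; rewrite eqxx. Qed.

Lemma map_updv_notin S sg y a : y \notin S -> map (updv sg y a) S = map sg S.
Proof.
move=> y_S; apply/eq_in_map => v v_S; rewrite /updv.
by case: eqP v_S y_S => // -> ->.
Qed.

Lemma restr_updv_notin D sg y a : y \notin D -> restr D (updv sg y a) = restr D sg.
Proof.
move=> y_D; apply/eqP/restr_eqP => v v_D; rewrite /updv.
by case: eqP v_D y_D => // -> ->.
Qed.

(** Tuples of values for the variables outside [S] correspond bijectively to the assignments that
    agree with [sg] on [S]. This is why a [TSum] term evaluates to a marginal mass. *)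
Lemma big_restr_upds D vs S (X : team A D) sg : uniq vs -> D =i vs ->
  {subset S <= vs} ->
  \sum_(t : (size [seq v <- vs | v \notin S]).-tuple A)
     X (restr D (upds sg [seq v <- vs | v \notin S] t))
  = mass X S (looks (restr D sg) S).
Proof.
move=> Uvs Dvs subS; set ys := filter _ _.
have subD : {subset S <= D} by move=> v /subS; rewrite Dvs.
have Uys : uniq ys by rewrite filter_uniq.
have updsS (t : (size ys).-tuple A) : {in S, upds sg ys t =1 sg}.
  by move=> v v_S; apply: upds_off; rewrite mem_filter v_S.
rewrite /mass (reindex (fun t : (size ys).-tuple A => restr D (upds sg ys t))) /=.
  apply: eq_bigl => t; apply/esym/looks_eqP => //; exact: updsS.
(* The inverse reads the tuple off the assignment. *)
exists (fun s => map_tuple (override s sg) (in_tuple ys)) => [t _|s].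
  apply: val_inj => /=; rewrite -[RHS](map_upds sg Uys (size_tuple t)).
  apply/eq_in_map => v; rewrite mem_filter => /andP[_ v_vs].
  by rewrite /override look_restr // Dvs.
rewrite inE => /eqP E.
rewrite -[s in RHS](restr_override s sg); apply/eqP/restr_eqP => v vD.
have [v_S|v_S] := boolP (v \in S).
  rewrite updsS //; move: E; rewrite -(restr_override s sg) => /eqP.
  by move/(looks_eqP _ _ subD) => /(_ v v_S); rewrite restr_override.
have v_ys : v \in ys by rewrite mem_filter v_S -Dvs.
have /eq_in_map := map_upds sg Uys (size_tuple (map_tuple (override s sg) (in_tuple ys))).
exact.
Qed.

End Assignments.

(** * Teams as distributions on tuples, and supplementation *)

Section Teams.
Variable A : finType.
Implicit Types (D : {fset nat}) (vs S : seq nat) (sg : nat -> A).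

Lemma mass_all D vs (X : team A D) sg : uniq vs -> D =i vs ->
  mass X vs (map Some (map sg vs)) = X (restr D sg).
Proof.
move=> Uvs Dvs; have subD : {subset vs <= D} by move=> v; rewrite Dvs.
rewrite /mass -(looks_restr sg subD) (big_pred1 (restr D sg)) // => s.
rewrite /= -(restr_override s sg).
apply/(looks_eqP _ _ subD)/restr_eqP => E v v_in; apply: E; last exact: subD.
by rewrite -Dvs.
Qed.

Lemma mass_nil D (X : team A D) : mass X [::] [::] = \sum_s X s.
Proof. by apply: eq_bigl => s; rewrite eqxx. Qed.

Lemma sum_mass D vs (X : team A D) sg : uniq vs -> D =i vs ->
  \sum_(t : (size vs).-tuple A) mass X vs (map Some t) = \sum_s X s.
Proof.
move=> Uvs Dvs; have subD : {subset vs <= D} by move=> v; rewrite Dvs.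
rewrite (partition_big (fun s => map_tuple (override s sg) (in_tuple vs)) xpredT) //=.
apply: eq_bigr => t _; apply: eq_bigl => s.
rewrite -{1}(restr_override s sg) looks_restr // -val_eqE /=.
by rewrite (inj_eq (inj_map (@Some_inj _))).
Qed.

Lemma sum_upds_singleton (F : (nat -> A) -> R) sg y :
  \sum_(t : (size [:: y]).-tuple A) F (upds sg [:: y] t)
  = \sum_c F (updv sg y c).
Proof.
rewrite (reindex (fun c => [tuple of [:: c]])) /=.
  apply: eq_bigr => c _; congr F.
  by apply: functional_extensionality => v; rewrite upds1.
exists (@thead 0 A) => [c _|t _]; first by rewrite theadE.
by apply: val_inj; case: t => [[|c [|d s]]] //= sz.
Qed.

Definition updT (env : nat * nat -> seq A -> R) m vs D (Y : team A D) :=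
  @updF A env (m, size vs) [ffun t : (size vs).-tuple A => mass Y vs (map Some t)].

(** The domain [D] is kept apart from the list [vs]: a quantifier turns them into the set of [D]
    with [x] added and into [requant x vs], and only the extensional equality [D =i vs] is carried
    along. *)
Definition represents (env : nat * nat -> seq A -> R) n vs D (X : team A D) :=
  forall sg, env (n, size vs) (map sg vs) = X (restr D sg).

Lemma updT_represents env m vs D (Y : team A D) : uniq vs -> D =i vs ->
  represents (updT env m vs Y) m vs Y.
Proof.
move=> Uvs Dvs sg; rewrite /updT /updF eqxx.
case: insubP => [t _ tE|]; last by rewrite size_map eqxx.
by rewrite ffunE tE mass_all.
Qed.

Lemma updT_other env m vs D (Y : team A D) n us D' (X : team A D') :
  m != n -> represents env n us X -> represents (updT env m vs Y) n us X.
Proof.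
move=> mn rep sg; rewrite /updT /updF.
case: eqP => [[/esym/eqP]|_]; last exact: rep.
by rewrite (negbTE mn).
Qed.

(** Taking masses is onto the distributions on tuples, so a function quantifier ranges over
    probabilistic teams. *)
Lemma exists_ffun_team vs D sg (P : {ffun (size vs).-tuple A -> R} -> Prop) :
  uniq vs -> D =i vs ->
  (exists g : {ffun (size vs).-tuple A -> R},
     [/\ forall t, 0 <= g t, \sum_t g t = 1 & P g])
  <-> (exists Y : team A D, is_prob Y /\ P [ffun t : (size vs).-tuple A => mass Y vs (map Some t)]).
Proof.
move=> Uvs Dvs; split=> [[g [g0 g1 Pg]]|[Y [[Y0 Y1] PY]]]; last first.
  exists [ffun t : (size vs).-tuple A => mass Y vs (map Some t)]; split=> //.
    by move=> t; rewrite ffunE; apply: sumr_ge0.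
  by rewrite -Y1 -(sum_mass Y sg Uvs Dvs); apply: eq_bigr => t _; rewrite ffunE.
(* The weight of [s] is [g] at its tuple of values; [sg] is a mere filler, since [vs] exhausts
   [D]. *)
pose Y (s : asg A D) := g (map_tuple (override s sg) (in_tuple vs)).
have gE t : mass Y vs (map Some (t : (size vs).-tuple A)) = g t.
  rewrite -{1}(map_upds sg Uvs (size_tuple t)) mass_all // /Y; congr (g _).
  apply: val_inj; rewrite /= -[RHS](map_upds sg Uvs (size_tuple t)).
  by apply/eq_in_map => v v_vs; rewrite /override look_restr // Dvs.
exists Y; split; last by congr P: Pg; apply/ffunP => t; rewrite ffunE gE.
split; first by move=> s; apply: g0.
by rewrite -(sum_mass Y sg Uvs Dvs) -g1; apply: eq_bigr => t _; rewrite gE.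
Qed.

Lemma sum_supd D (X : team A D) F (x : nat) (P : pred (asg A (x |` D))) :
  \sum_(s | P s) @supd A D X F x s
  = \sum_t \sum_(a | P (@ext A D t x a)) X t * F t a.
Proof.
rewrite /supd exchange_big /=; apply: eq_bigr => t _.
rewrite exchange_big /= [RHS]big_mkcond; apply: eq_bigr => a _.
rewrite -big_mkcondr /=; case: ifP => Pa.
  rewrite (big_pred1 (ext t x a)) => [|s] //; rewrite [pred1 _ _]eq_sym andbC.
  by case: eqP => // <-.
by apply: big_pred0 => s; rewrite andbC; case: eqP => // <-.
Qed.

(** If [x] already lies in [D], assignments that differ only at [x] collapse, hence a sum over all
    [t] agreeing off [x]. *)
Lemma supd_restr D vs (x : nat) (X : team A D) F sg : D =i vs ->
  let vs0 := [seq v <- vs | v != x] in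
  @supd A D X F x (restr (x |` D) sg)
  = \sum_(t | looks t vs0 == looks (restr D sg) vs0) X t * F t (sg x).
Proof.
move=> Dvs vs0; rewrite /supd [RHS]big_mkcond; apply: eq_bigr => t _.
have sub0 : {subset vs0 <= D} by move=> v; rewrite mem_filter Dvs => /andP[].
rewrite -(restr_override t sg); set tau := override t sg.
have eqE a : (ext (restr D tau) x a == restr (x |` D) sg)
           = (looks (restr D tau) vs0 == looks (restr D sg) vs0) && (a == sg x).
  rewrite ext_restr; apply/restr_eqP/andP => [E|[/(looks_eqP _ _ sub0) E /eqP a_x] v].
    split; last by rewrite -(E x) ?fset1U1 // /updv eqxx.
    apply/looks_eqP => // v; rewrite mem_filter => /andP[v_x v_vs].
    by rewrite -(E v) /updv ?(negbTE v_x) // !inE Dvs v_vs orbT.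
  rewrite !inE /updv; case: eqP => [->|/eqP v_x /=] //.
  by rewrite Dvs => v_vs; apply: E; rewrite mem_filter v_x.
under eq_bigr do rewrite eqE.
case: (looks _ _ == _) => /=; last by rewrite big1.
by rewrite -big_mkcond big_pred1_eq.
Qed.

Lemma supd_prob D (X : team A D) F (x : nat) : is_prob X ->
  (forall t, (forall a, 0 <= F t a) /\ \sum_a F t a = 1) -> is_prob (@supd A D X F x).
Proof.
move=> [X0 X1] Fp; split=> [s|].
  apply: sumr_ge0 => t _; apply: sumr_ge0 => a _; case: ifP => // _.
  by apply: mulr_ge0; [exact: X0 | exact: (Fp t).1].
rewrite (sum_supd X F xpredT) -X1; apply: eq_bigr => t _.
by rewrite -big_distrr /= (Fp t).2 mulr1.
Qed.

Lemma mass_supd D (x : nat) S (X : team A D) F sg : {subset S <= D} -> x \notin S ->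
  (forall t, \sum_a F t a = 1) ->
  mass (@supd A D X F x) S (looks (restr (x |` D) sg) S)
  = mass X S (looks (restr D sg) S).
Proof.
move=> subS x_S F1; rewrite /mass sum_supd [RHS]big_mkcond; apply: eq_bigr => t _.
have subS' : {subset S <= x |` D} by move=> v v_S; rewrite !inE subS ?orbT.
rewrite -(restr_override t sg); set tau := override t sg.
have eqE a : (looks (ext (restr D tau) x a) S == looks (restr (x |` D) sg) S)
           = (looks (restr D tau) S == looks (restr D sg) S).
  by rewrite ext_restr !looks_restr // map_updv_notin.
under eq_bigl do rewrite eqE.
case: (looks _ _ == _); last by rewrite big_pred0.
by rewrite -big_distrr /= F1 mulr1.
Qed.

End Teams.

(** * Quantifiers and disjunction as conditions on joint distributions *)

Section Connectives.
Variable A : finType.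
Implicit Types (D : {fset nat}) (vs S : seq nat) (sg : nat -> A).

Lemma restr_local D vs sg sg' : D =i vs -> {in vs, sg =1 sg'} ->
  restr D sg = restr D sg'.
Proof. by move=> Dvs E; apply/eqP/restr_eqP => v; rewrite Dvs; apply: E. Qed.

Lemma filter_notin_self (x : nat) vs : x \notin vs ->
  [seq v <- x :: vs | v \notin vs] = [:: x].
Proof.
move=> x_vs; rewrite /= x_vs (@eq_in_filter _ _ pred0) ?filter_pred0 // => v.
by move=> ->.
Qed.

Lemma mass_tail D x vs (X : team A D) sg : uniq (x :: vs) -> D =i x :: vs ->
  mass X vs (looks (restr D sg) vs) = \sum_c X (restr D (updv sg x c)).
Proof.
move=> Uvs Dvs; have /andP[x_vs _] := Uvs.
rewrite -(sum_upds_singleton (fun tau => X (restr D tau))).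
rewrite -(big_restr_upds X sg Uvs Dvs); first by rewrite filter_notin_self.
by move=> v v_vs; rewrite inE v_vs orbT.
Qed.

Lemma sum_restr_upds D vs (X : team A D) sg : uniq vs -> D =i vs ->
  \sum_(t : (size vs).-tuple A) X (restr D (upds sg vs t)) = \sum_s X s.
Proof.
move=> Uvs Dvs; rewrite -mass_nil.
have := @big_restr_upds A D vs [::] X sg Uvs Dvs.
by rewrite (@eq_filter _ _ predT) ?filter_predT // => ->.
Qed.

(** The old value of [x], if there is one, is summed out on the left and the new one on the right.
    This is the exact condition for [Y] to arise from [X] by supplementation at [x]. *)
Definition marginal_of D (x : nat) vs (X : team A D) (Y : team A (x |` D)) :=
  forall sg, mass X [seq v <- vs | v != x] (looks (restr D sg) [seq v <- vs | v != x])
             = \sum_c Y (restr (x |` D) (updv sg x c)).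

Lemma fsetU1_requant D (x : nat) vs : D =i vs -> x |` D =i requant x vs.
Proof. by move=> Dvs v; rewrite mem_requant !inE Dvs. Qed.

Lemma marginal_of_supd D (x : nat) vs (X : team A D) F : uniq vs -> D =i vs ->
  (forall t, \sum_a F t a = 1) -> marginal_of vs X (@supd A D X F x).
Proof.
move=> Uvs Dvs F1 sg; have x_vs0 : x \notin [seq v <- vs | v != x].
  by rewrite mem_filter eqxx.
rewrite -(@mass_tail _ x [seq v <- vs | v != x]) ?requant_uniq //; last first.
  exact: fsetU1_requant.
by rewrite mass_supd // => v; rewrite mem_filter Dvs => /andP[].
Qed.

Lemma updvE sg x a : updv sg x a x = a.
Proof. by rewrite /updv eqxx. Qed.

Lemma updv_id sg x : updv sg x (sg x) = sg.
Proof. by apply: functional_extensionality => v; rewrite /updv; case: eqP => [->|]. Qed.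

Lemma team_eq D (X Y : team A D) sg :
  (forall tau, X (restr D tau) = Y (restr D tau)) -> X = Y.
Proof.
move=> E; apply: functional_extensionality => s.
by rewrite -(restr_override s sg) E.
Qed.

Lemma sumr_card (r : R) : \sum_(a : A) r = r * #|A|%:R.
Proof. by rewrite sumr_const mulr_natr. Qed.

(** Disintegration: supplementing keeps the marginal off [x], and conversely a team with that
    marginal is rebuilt from the conditional law of [x] given the rest. This law may ignore the old
    value of [x], since only sums over that value survive. *)
Lemma exists_supdP D (x : nat) vs (X : team A D) sg (P : team A (x |` D) -> Prop) :
  uniq vs -> D =i vs -> is_prob X ->
  (exists F : asg A D -> A -> R,
     (forall t, (forall a, 0 <= F t a) /\ \sum_a F t a = 1) /\ P (supd X F (x := x)))
  <-> (exists Y, is_prob Y /\ (marginal_of vs X Y /\ P Y)).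
Proof.
move=> Uvs Dvs Xp; split=> [[F [Fp PF]]|[Y [[Y0 Y1] [XY PY]]]].
  exists (@supd A D X F x); split; first exact: supd_prob.
  by split=> //; apply: marginal_of_supd => // t; case: (Fp t).
pose vs0 := [seq v <- vs | v != x].
have sub0 : {subset vs0 <= D} by move=> v; rewrite mem_filter Dvs => /andP[].
have [X0 _] := Xp.
pose m (t : asg A D) := mass X vs0 (looks t vs0).
have mE t : m t = \sum_a Y (ext t x a).
  rewrite -(restr_override t sg) [m _]XY.
  by apply: eq_bigr => a _; rewrite ext_restr.
have A_gt0 : #|A|%:R != 0 :> R by rewrite pnatr_eq0 -lt0n; apply/card_gt0P; exists (sg 0%nat).
(* conditional law of the new value of [x] given the other variables *)
pose F (t : asg A D) a := if m t == 0 then #|A|%:R^-1 else Y (ext t x a) / m t.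
have m_ge0 t : 0 <= m t by apply: sumr_ge0.
exists F; split.
  move=> t; rewrite /F; case: eqVneq => [_|m_neq0].
    split=> [a|]; first by rewrite invr_ge0 ler0n.
    by rewrite sumr_card mulVf.
  split=> [a|]; first by apply: divr_ge0.
  by rewrite -big_distrl /= -mE divff.
suff -> : @supd A D X F x = Y by [].
apply: (@team_eq _ _ _ sg) => tau; rewrite (supd_restr _ _ _ _ Dvs) -/vs0.
have ext_eq t : looks t vs0 == looks (restr D tau) vs0 ->
    m t = m (restr D tau) /\ ext t x (tau x) = restr (x |` D) tau.
  move=> E; split; first by rewrite /m (eqP E).
  move: E; rewrite -(restr_override t sg) => /(looks_eqP _ _ sub0) E.
  rewrite ext_restr; apply/eqP/restr_eqP => v; rewrite !inE /updv.
  by case: eqP => [->|/eqP v_x] //=; rewrite Dvs => v_vs; apply: E; rewrite mem_filter v_x.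
(* On the range of summation [F t] has a constant value at [tau x], so it factors out and leaves the
   marginal mass of [X]. *)
have {ext_eq}FE t : looks t vs0 == looks (restr D tau) vs0 ->
    X t * F t (tau x) = X t * (if m (restr D tau) == 0 then #|A|%:R^-1
                               else Y (restr (x |` D) tau) / m (restr D tau)).
  by move=> /ext_eq[mt et]; rewrite /F mt et.
rewrite (eq_bigr _ FE) -big_distrl /= -/(mass X vs0 _) -/(m _).
(* At mass 0 any default law works: the weights of [Y] there are nonnegative with sum 0, so each of
   them vanishes. *)
case: eqVneq => [m0|m_neq0]; last by rewrite mulrCA divff ?mulr1.
rewrite m0 mul0r; move: m0; rewrite mE => /eqP.
rewrite psumr_eq0 // => /allP/(_ (tau x)); rewrite mem_index_enum => /(_ isT).
by rewrite /= ext_restr updv_id => /eqP.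
Qed.

(** Invariance in [x] and the marginal together determine [Y]: the marginal consists of $|A|$ equal
    weights. The existential quantifier thus has exactly one candidate. *)
Lemma supd_uniformP D (x : nat) vs (X : team A D) sg (P : team A (x |` D) -> Prop) :
  uniq vs -> D =i vs -> is_prob X ->
  P (@supd A D X (fun _ _ => #|A|%:R^-1) x)
  <-> (exists Y, is_prob Y /\ (marginal_of vs X Y /\
        ((forall tau c, Y (restr _ tau) = Y (restr _ (updv tau x c))) /\ P Y))).
Proof.
move=> Uvs Dvs Xp.
have A_gt0 : #|A|%:R != 0 :> R by rewrite pnatr_eq0 -lt0n; apply/card_gt0P; exists (sg 0%nat).
have Fp : (forall a : A, 0 <= #|A|%:R^-1 :> R) /\ \sum_(a : A) #|A|%:R^-1 = 1 :> R.
  by split=> [a|]; rewrite ?invr_ge0 ?ler0n // sumr_card mulVf.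
split=> [PX|[Y [Yp [XY [Yx PY]]]]].
  exists (@supd A D X (fun _ _ => #|A|%:R^-1) x); split; first exact: supd_prob.
  split; first by apply: marginal_of_supd => // t; case: Fp.
  split=> // tau c; rewrite !(supd_restr _ _ _ _ Dvs) /= !looks_restr.
  - by rewrite map_updv_notin // mem_filter eqxx.
  - by move=> v; rewrite mem_filter Dvs => /andP[].
  - by move=> v; rewrite mem_filter Dvs => /andP[].
suff -> : @supd A D X (fun _ _ => #|A|%:R^-1) x = Y by [].
apply: (@team_eq _ _ _ sg) => tau; rewrite (supd_restr _ _ _ _ Dvs) -big_distrl /=.
have := XY tau; rewrite /mass => ->.
under eq_bigr => c _ do rewrite -Yx.
by rewrite sumr_card -mulrA divff ?mulr1.
Qed.

Definition is_mixture D (y : nat) a (X Y Z : team A D) (W : team A (y |` D)) :=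
  forall sg, let w := mass W [:: y] (looks (restr (y |` D) sg) [:: y]) in
    X (restr D sg) = \sum_c W (restr _ (updv sg y c)) /\
    ((sg y = a /\ W (restr _ sg) = w * Y (restr D sg)) \/
    (sg y <> a /\ W (restr _ sg) = w * Z (restr D sg))).

Lemma uniq_team_card1 D (X Y : team A D) a : (forall c : A, c = a) ->
  is_prob X -> is_prob Y -> X = Y.
Proof.
move=> A1 [_ X1] [_ Y1].
have E (Z : team A D) s : \sum_s' Z s' = 1 -> Z s = 1.
  rewrite (big_pred1 s) // => s' /=; apply/esym/eqP/ffunP => v.
  by rewrite (A1 (s' v)) (A1 (s v)).
by apply: functional_extensionality => s; rewrite !E.
Qed.

(* If A has a single element, there is only one team over D, and the weight
   k, which no distribution on A can then encode, is immaterial. *)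
Lemma mixture_weight D (X Y Z : team A D) k (a : A) :
  0 <= k <= 1 -> is_prob X -> is_prob Y -> is_prob Z ->
  (forall s, X s = k * Y s + (1 - k) * Z s) ->
  exists d : A -> R, [/\ forall c, 0 <= d c, \sum_c d c = 1 &
    forall s, X s = d a * Y s + (1 - d a) * Z s].
Proof.
move=> /andP[k0 k1] Xp Yp Zp XE.
have [b b_a|A1] := pickP (fun b : A => b != a); last first.
  have {}A1 c : c = a by apply/eqP; move: (A1 c) => /negbFE.
  exists (fun=> 1); split=> // [|s].
    by rewrite (big_pred1 a) // => c; rewrite /= (A1 c) eqxx.
  by rewrite subrr mul0r addr0 mul1r (uniq_team_card1 A1 Xp Yp).
exists (fun c => if c == a then k else if c == b then 1 - k else 0); split.
- by move=> c; case: eqP => // _; case: eqP => // _; rewrite subr_ge0.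
- rewrite (bigD1 a) //= (bigD1 b) //= eqxx (negbTE b_a) eqxx big1 ?addr0.
    by rewrite addrC subrK.
  by move=> c /andP[/negbTE-> /negbTE->].
- by rewrite eqxx.
Qed.

(** From a disjunction, the selector gets the law supplied by [mixture_weight]. Conversely $k$ is
    the mass at [a], and the masses at all other values add up to $1-k$, so the complement never has
    to be expressed by a term. *)
Lemma joinP D (y : nat) vs (X : team A D) sg (P Q : team A D -> Prop) :
  uniq (y :: vs) -> D =i vs -> is_prob X ->
  (exists (Y Z : team A D) (k : R), [/\ 0 <= k <= 1, is_prob Y, is_prob Z,
     (forall s, X s = k * Y s + (1 - k) * Z s) & P Y /\ Q Z])
  <-> (exists a, exists Y, is_prob Y /\ exists Z, is_prob Z /\
       exists W : team A (y |` D), is_prob W /\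
        (is_mixture a X Y Z W /\ (P Y /\ Q Z))).
Proof.
move=> Uyvs Dvs Xp; have /andP[y_vs Uvs] := Uyvs.
have y_D : y \notin D by rewrite Dvs.
have Dyvs : y |` D =i y :: vs by move=> v; rewrite !inE Dvs.
have sub_y : {subset [:: y] <= y |` D} by move=> v; rewrite !inE => ->.
have sum_W (W : team A (y |` D)) :
    \sum_c mass W [:: y] [:: Some c] = \sum_s W s.
  rewrite (partition_big (fun s : asg A (y |` D) => override s sg y) xpredT) //=.
  apply: eq_bigr => c _; apply: eq_bigl => s.
  rewrite -{1}(restr_override s sg) looks_restr //=.
  by rewrite eqseq_cons andbT (inj_eq (@Some_inj _)).
split=> [[Y [Z [k [k01 Yp Zp XE [PY QZ]]]]]|[a [Y [Yp [Z [Zp [W [[W0 W1] [mixW [PY QZ]]]]]]]]]].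
  pose a := sg 0%nat; exists a.
  have [d [d0 d1 dE]] := mixture_weight a k01 Xp Yp Zp XE.
  exists Y; split=> //; exists Z; split=> //.
  pose W (s : asg A (y |` D)) :=
    let tau := override s sg in
    d (tau y) * (if tau y == a then Y (restr D tau) else Z (restr D tau)).
  have WE tau : W (restr _ tau)
      = d (tau y) * (if tau y == a then Y (restr D tau) else Z (restr D tau)).
    have oE v : v \in y :: vs -> override (restr (y |` D) tau) sg v = tau v.
      by move=> v_in; rewrite /override look_restr ?Dyvs.
    rewrite /W /= oE ?mem_head // (restr_local (sg' := tau) Dvs) // => v v_vs.
    by rewrite oE // inE v_vs orbT.
  (* Given the selector value, the remaining weights sum to 1 because [Y] and [Z] do, so [d] is the
     marginal of the selector. *)
  have massW tau : mass W [:: y] (looks (restr (y |` D) tau) [:: y]) = d (tau y).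
    rewrite -(big_restr_upds W tau Uyvs Dyvs); last by move=> v; rewrite !inE => ->.
    have -> : [seq v <- y :: vs | v \notin [:: y]] = vs.
      rewrite /= inE eqxx /=; apply/all_filterP/allP => v v_vs; rewrite inE.
      by apply: contraNneq y_vs => <-.
    under eq_bigr => t _ do rewrite WE upds_off //.
    rewrite -big_distrr /=; case: (tau y == a).
      by rewrite sum_restr_upds // Yp.2 mulr1.
    by rewrite sum_restr_upds // Zp.2 mulr1.
  exists W; split; first split.
  - move=> s; apply: mulr_ge0 => //; case: ifP => _; [exact: Yp.1 | exact: Zp.1].
  - rewrite -sum_W -d1; apply: eq_bigr => c _.
    rewrite -[c in RHS]/((fun=> c) y : A) -massW looks_restr //.
  split=> // tau w; split.
    rewrite dE (bigD1 a) //= WE restr_updv_notin // !updvE eqxx; congr (_ + _).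
    have -> : 1 - d a = \sum_(c | c != a) d c.
      by rewrite -d1 [X in X - _](bigD1 a) //= addrAC subrr add0r.
    rewrite big_distrl /=; apply: eq_bigr => c c_a.
    by rewrite WE restr_updv_notin // updvE (negbTE c_a).
  rewrite /w massW WE; case: eqP => E; [by left|by right].
pose e c := mass W [:: y] [:: Some c].
have e_ge0 c : 0 <= e c by apply: sumr_ge0.
have e_sum : e a + \sum_(c | c != a) e c = 1 by rewrite -W1 -sum_W [RHS](bigD1 a).
exists Y, Z, (e a); split=> //.
  by rewrite e_ge0 -e_sum lerDl sumr_ge0.
move=> s; rewrite -(restr_override s sg); set tau := override s sg.
have [-> _] := mixW tau.
have eE c : mass W [:: y] (looks (restr (y |` D) (updv tau y c)) [:: y]) = e c.
  by rewrite looks_restr //= updvE.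
have -> : 1 - e a = \sum_(c | c != a) e c by rewrite -e_sum addrAC subrr add0r.
(* The selector value [a] contributes the share of [Y]; all other values together contribute that of
   [Z]. *)
rewrite (bigD1 a) //=; congr (_ + _).
  have [_] := mixW (updv tau y a); rewrite eE (restr_updv_notin _ _ y_D) updvE.
  by case=> -[].
rewrite big_distrl /=; apply: eq_bigr => c c_a.
have [_] := mixW (updv tau y c); rewrite eE (restr_updv_notin _ _ y_D) updvE.
by case=> -[] // ca; move: c_a; rewrite ca eqxx.
Qed.

End Connectives.

(** * Correctness of the translation *)

Section Correctness.
Variables (Sym : finType) (ar : Sym -> nat).
Variables (A : finType) (I : forall r : Sym, {set (ar r).-tuple A}).
Implicit Types (D : {fset nat}) (vs S : seq nat) (sg : nat -> A).
Implicit Types (p q : soform ar).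

Lemma ssat_alls vs p sg env :
  ssat I sg env (alls vs p) <->
  forall sg', agree_off vs sg sg' -> ssat I sg' env p.
Proof.
elim: vs sg => [|v vs IH] sg /=.
  split=> [sat_p sg' E|]; last exact.
  by rewrite (_ : sg' = sg) //; apply: functional_extensionality => y; apply: E.
split=> [H sg' E|H a].
  have /IH := H (sg' v); apply => y y_vs; rewrite /updv; case: eqP => [->|/eqP y_v] //.
  by apply: E; rewrite inE negb_or y_v.
apply/IH => sg' E; apply: H => y; rewrite inE negb_or => /andP[y_v y_vs].
by rewrite E // /updv (negbTE y_v).
Qed.

(** A property that sees only [vs] does not depend on the base valuation. The first hypothesis is
    confined to valuations agreeing with [sg] off [vs], so that [p] may mention an outer variable,
    such as the marked element of a mixture. *)
Lemma ssat_alls_local vs p sg env (P : (nat -> A) -> Prop) :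
  (forall sg', agree_off vs sg sg' -> (ssat I sg' env p <-> P sg')) ->
  (forall sg1 sg2, {in vs, sg1 =1 sg2} -> P sg1 -> P sg2) ->
  ssat I sg env (alls vs p) <-> forall sg', P sg'.
Proof.
move=> pP Ploc; rewrite ssat_alls; split=> H sg'; last by move=> /pP E; apply/E.
(* Splicing: the arbitrary valuation on [vs], the base valuation elsewhere. *)
pose tau v := if v \in vs then sg' v else sg v.
have tau_off : agree_off vs sg tau by move=> v /negbTE v_vs; rewrite /tau v_vs.
apply: (Ploc tau); first by move=> v v_vs; rewrite /tau v_vs.
by apply/(pP _ tau_off)/H.
Qed.

(** Both function quantifiers range over the same distributions, so they are dual to each other by
    classical logic. *)
Lemma ssat_sneg p sg env : ssat I sg env (sneg p) <-> ~ ssat I sg env p.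
Proof.
elim: p sg env =>
  [i j|i j|r xs|r xs|x y|x y|p IHp q IHq|p IHp q IHq|x p IH|x p IH|f p IH|f p IH]
  sg env //=.
- by split=> [->|/NNPP]; [apply|].
- by split=> /negP.
- by split=> [H|/negP]; [apply/negP; rewrite negbK | rewrite negbK].
- by split=> [->|/NNPP]; [apply|].
- by rewrite IHp IHq; split=> [[] np []|/not_and_or].
- by rewrite IHp IHq; split=> [[np nq] []|/not_or_and].
- split=> [H [a] /[dup]|H a]; first by have /IH := H a.
  by apply/IH => sat_p; apply: H; exists a.
- split=> [[a /IH np] H|/not_all_ex_not[a np]]; first exact: np (H a).
  by exists a; apply/IH.
- split=> [H [g [g0 g1]]|H g g0 g1]; first by have /IH := H g g0 g1.
  by apply/IH => sat_p; apply: H; exists g.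
- split=> [[g [g0 g1 /IH np]] H|H]; first exact: np (H g g0 g1).
  apply: NNPP => nex; apply: H => g g0 g1; apply: NNPP => np.
  by apply: nex; exists g; split=> //; apply/IH.
Qed.

Lemma teval_mul sg env i j :
  teval sg env (TMul i j) = teval sg env i * teval sg env j.
Proof. by []. Qed.

Section Represented.
Variables (D : {fset nat}) (vs : seq nat) (n : nat) (X : team A D).
Variable env : nat * nat -> seq A -> R.
Hypotheses (Uvs : uniq vs) (Dvs : D =i vs) (rep : represents env n vs X).

Lemma teval_fapp sg : teval sg env (fapp n vs) = X (restr D sg).
Proof. exact: rep. Qed.

Lemma teval_marg sg S : {subset S <= vs} ->
  teval sg env (marg n vs S) = mass X S (looks (restr D sg) S).
Proof.
move=> subS; rewrite -(big_restr_upds X sg Uvs Dvs subS).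
by apply: eq_bigr => t _; apply: rep.
Qed.

Lemma ssat_iszero sg : is_prob X ->
  ssat I sg env (iszero ar n vs) <-> X (restr D sg) = 0.
Proof.
move=> [X0 X1]; cbn [ssat iszero].
rewrite teval_mul teval_fapp teval_marg // mass_nil X1.
split=> [[XX Xn1]|->]; last first.
  by rewrite mul0r; split=> // /eqP; rewrite eq_sym oner_eq0.
apply/eqP; apply: contra_notT Xn1 => Xn0; apply: (mulfI Xn0).
by rewrite XX mulr1.
Qed.

(** Literals are checked on the support one assignment at a time, so a single argument serves all
    four; the support condition becomes the disjunction with a zero test. *)
Lemma ssat_atom sg q (P : asg A D -> Prop) : is_prob X ->
  (forall sg', ssat I sg' env q <-> P (restr D sg')) ->
  (forall s, X s != 0 -> P s) <-> ssat I sg env (alls vs (SOr (iszero ar n vs) q)).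
Proof.
move=> Xp qP; rewrite (@ssat_alls_local _ _ _ _
  (fun tau => X (restr D tau) = 0 \/ P (restr D tau))); first last.
- by move=> sg1 sg2 /(restr_local Dvs) ->.
- by move=> tau _; cbn [ssat]; rewrite ssat_iszero // qP.
split=> [H tau|H s].
  by have [X0|/eqP/H] := classic (X (restr D tau) = 0); [left | right].
by rewrite -(restr_override s sg); have [-> /eqP|] := H (override s sg).
Qed.

End Represented.

Lemma ssat_exists_team D vs m env sg p : uniq vs -> D =i vs ->
  ssat I sg env (SExF (m, size vs) p) <->
  exists Y : team A D, is_prob Y /\ ssat I sg (updT env m vs Y) p.
Proof.
move=> Uvs Dvs.
exact: (@exists_ffun_team A vs D sg
  (fun g => ssat I sg (@updF A env (m, size vs) g) p)).
Qed.

Lemma ssat_same_marg D vs n x env sg (X : team A D) (Y : team A (x |` D)) :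
  uniq vs -> D =i vs -> represents env n vs X ->
  represents env n.+1 (requant x vs) Y ->
  ssat I sg env (same_marg ar n vs x) <-> marginal_of vs X Y.
Proof.
move=> Uvs Dvs repX repY; have Dxvs := fsetU1_requant x Dvs.
have Uxvs := requant_uniq x Uvs.
have sub0 : {subset [seq v <- vs | v != x] <= D}.
  by move=> v; rewrite mem_filter Dvs => /andP[].
apply: ssat_alls_local => [tau _|sg1 sg2 E].
  cbn [ssat]; rewrite (teval_marg Uvs Dvs repX); last first.
    by move=> v; rewrite mem_filter => /andP[].
  rewrite (teval_marg Uxvs Dxvs repY); last by move=> v v_in; rewrite inE v_in orbT.
  by rewrite (mass_tail _ _ Uxvs Dxvs).
have -> : looks (restr D sg1) [seq v <- vs | v != x]
        = looks (restr D sg2) [seq v <- vs | v != x].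
  by apply/eqP/looks_eqP.
move=> ->; apply: eq_bigr => c _; congr Y; apply: (restr_local Dxvs) => v.
rewrite inE /updv; case: eqP => //= _; exact: E.
Qed.

Lemma ssat_uniform_in D vs n x env sg (Y : team A (x |` D)) :
  uniq vs -> D =i vs -> represents env n (requant x vs) Y ->
  ssat I sg env (uniform_in ar n vs x) <->
  forall tau c, Y (restr _ tau) = Y (restr _ (updv tau x c)).
Proof.
move=> Uvs Dvs repY; have Dxvs := fsetU1_requant x Dvs.
set y := fresh (requant x vs); have y_xvs : y \notin requant x vs := fresh_notin _.
have x_vs0 : x \notin [seq v <- vs | v != x] by rewrite mem_filter eqxx.
rewrite (@ssat_alls_local _ _ _ _
  (fun tau => Y (restr _ tau) = Y (restr _ (updv tau x (tau y))))); first last.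
- move=> sg1 sg2 E; have E' : {in requant x vs, sg1 =1 sg2}.
    by move=> v v_in; apply: E; rewrite inE v_in orbT.
  rewrite (restr_local Dxvs E') => ->; congr Y; apply: (restr_local Dxvs) => v v_in.
  by rewrite /updv (E y) ?mem_head // E'.
- move=> tau _; cbn [ssat]; rewrite (teval_fapp repY) -/y.
  have <- // : teval tau env (fapp n (y :: [seq v <- vs | v != x]))
             = Y (restr _ (updv tau x (tau y))).
  by rewrite -repY /= updvE map_updv_notin.
split=> [H tau c|H tau]; last exact: H.
have yx : (x == y) = false by apply: contraNF y_xvs => /eqP <-; rewrite mem_head.
have E v : v \in requant x vs -> updv tau y c v = tau v.
  by rewrite /updv; case: eqP y_xvs => // -> /negbTE->.
(* Giving the fresh [y] the value [c] yields invariance at [c], as [Y] does not see [y]. *)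
have := H (updv tau y c); rewrite updvE (restr_local Dxvs E) => ->.
congr Y; apply: (restr_local Dxvs) => v v_in.
by rewrite /updv; case: eqP => // _; apply: E.
Qed.

Lemma ssat_mixture D vs n y a env sg (X Y Z : team A D) (W : team A (y |` D)) :
  uniq (y :: vs) -> D =i vs -> a \notin y :: vs ->
  represents env n vs X -> represents env n.+1 vs Y ->
  represents env n.+2 vs Z -> represents env n.+3 (y :: vs) W ->
  ssat I sg env (mixture ar n vs y a) <-> is_mixture (sg a) X Y Z W.
Proof.
move=> Uyvs Dvs a_yvs repX repY repZ repW; have /andP[y_vs Uvs] := Uyvs.
have Dyvs : y |` D =i y :: vs by move=> v; rewrite !inE Dvs.
apply: ssat_alls_local => [tau tau_off|sg1 sg2 E].
  cbn [ssat]; rewrite !teval_mul (teval_fapp repX) (teval_fapp repY) (teval_fapp repZ).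
  rewrite (teval_fapp repW) !(teval_marg Uyvs Dyvs repW); first last.
  - by move=> v v_vs; rewrite inE v_vs orbT.
  - by move=> v; rewrite !inE => ->.
  by rewrite (mass_tail _ _ Uyvs Dyvs) (tau_off a).
have E' : {in vs, sg1 =1 sg2} by move=> v v_in; apply: E; rewrite inE v_in orbT.
have Es : \sum_c W (restr (y |` D) (updv sg1 y c))
        = \sum_c W (restr (y |` D) (updv sg2 y c)).
  apply: eq_bigr => c _; congr W; apply: (restr_local Dyvs) => v v_in.
  by rewrite /updv E.
rewrite /= Es (restr_local Dyvs E) (restr_local Dvs E').
by rewrite (E y) // mem_head.
Qed.

(** The induction varies the name, the list, the domain and the environment, all of which change
    under binders. Of the environment only the value at [(n, size vs)] is constrained, and [is_prob]
    persists because function quantifiers range over distributions. *)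
Lemma ssat_tr n vs phi D (X : team A D) env sg :
  uniq vs -> D =i vs -> {subset fv phi <= vs} -> is_prob X ->
  represents env n vs X -> sat I phi X <-> ssat I sg env (tr n vs phi).
Proof.
elim: phi n vs D X env sg =>
  [r xs|r xs|x y|x y|xs ys zs|p IH|p IHp q IHq|p IHp q IHq|x p IH|x p IH]
  n vs D X env sg Uvs Dvs sub Xp rep.
- apply: (ssat_atom Uvs Dvs rep) => // tau; cbn [ssat].
  rewrite looks_restr; last by move=> v /sub; rewrite Dvs.
  split=> [xs_r|[t [/(inj_map (@Some_inj _)) tE]]].
    by exists (map_tuple tau xs).
  by rewrite (_ : map_tuple tau xs = t) //; apply: val_inj.
- apply: (ssat_atom Uvs Dvs rep) => // tau; cbn [ssat].
  rewrite looks_restr; last by move=> v /sub; rewrite Dvs.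
  split=> [xs_r|[t [/(inj_map (@Some_inj _)) tE]]].
    by exists (map_tuple tau xs).
  by rewrite (_ : map_tuple tau xs = t) //; apply: val_inj.
- have xD : x \in D by rewrite Dvs sub // mem_head.
  have yD : y \in D by rewrite Dvs sub // !inE eqxx orbT.
  apply: (ssat_atom Uvs Dvs rep) => // tau; cbn [ssat]; rewrite !look_restr //.
  by split=> [->|[a [[->] [->]]]] //; exists (tau y).
- have xD : x \in D by rewrite Dvs sub // mem_head.
  have yD : y \in D by rewrite Dvs sub // !inE eqxx orbT.
  apply: (ssat_atom Uvs Dvs rep) => // tau; cbn [ssat]; rewrite !look_restr //.
  split=> [xy|[a [b [[->] [->] /eqP]]]] //; exists (tau x), (tau y); split=> //.
  exact/eqP.
- cbn [tr sat]; rewrite (@ssat_alls_local _ _ _ _ (fun tau => let u := restr D tau in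
    mass X (xs ++ ys) (looks u (xs ++ ys)) * mass X (xs ++ zs) (looks u (xs ++ zs))
    = mass X (xs ++ ys ++ zs) (looks u (xs ++ ys ++ zs)) * mass X xs (looks u xs))).
  + split=> [H tau|H u]; first exact: H.
    by rewrite -(restr_override u sg); apply: H.
  + have subv S : {subset S <= xs ++ ys ++ zs} -> {subset S <= vs}.
      by move=> subS v /subS; apply: sub.
    move=> tau _; cbn [ssat]; rewrite !teval_mul !(teval_marg Uvs Dvs rep) //;
      apply: subv => v; rewrite !mem_cat;
      by case: (v \in xs); case: (v \in ys); case: (v \in zs).
  + by move=> sg1 sg2 /(restr_local Dvs) ->.
- by cbn [tr sat]; rewrite ssat_sneg (IH n vs D X env sg).
- cbn [tr sat ssat]; rewrite (IHp n vs D X env sg) // ?(IHq n vs D X env sg) //.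
    by move=> v v_in; apply: sub; rewrite /= mem_cat v_in orbT.
  by move=> v v_in; apply: sub; rewrite /= mem_cat v_in.
- have subp : {subset fv p <= vs} by move=> v v_in; apply: sub; rewrite /= mem_cat v_in.
  have subq : {subset fv q <= vs}.
    by move=> v v_in; apply: sub; rewrite /= mem_cat v_in orbT.
  cbn [tr sat]; set y := fresh vs; set a := fresh (y :: vs).
  have Uyvs : uniq (y :: vs) by rewrite /= fresh_notin.
  have a_yvs : a \notin y :: vs := fresh_notin _.
  have Dyvs : y |` D =i y :: vs by move=> v; rewrite !inE Dvs.
  rewrite (joinP sg _ _ Uyvs Dvs Xp).
  (* The four teams coexist in one environment: distinct names prevent overwriting, although three
     of the arities coincide. *)
  have body c Y Z (W : team A (y |` D)) : is_prob Y -> is_prob Z ->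
      ssat I (updv sg a c)
        (updT (updT (updT env n.+1 vs Y) n.+2 vs Z) n.+3 (y :: vs) W)
        (SAnd (mixture ar n vs y a) (SAnd (tr n.+1 vs p) (tr n.+2 vs q)))
      <-> is_mixture c X Y Z W /\ (sat I p Y /\ sat I q Z).
    move=> Yp Zp; set env' := updT _ _ _ _.
    have neq1 m : m.+1 != m by rewrite -addn1 -[X in _ != X]addn0 eqn_add2l.
    have neq2 m : m.+2 != m by rewrite -addn2 -[X in _ != X]addn0 eqn_add2l.
    have neq3 m : m.+3 != m by rewrite -addn3 -[X in _ != X]addn0 eqn_add2l.
    have repX : represents env' n vs X by do 3![apply: updT_other => //].
    have repY : represents env' n.+1 vs Y.
      by do 2![apply: updT_other => //]; apply: updT_represents.
    have repZ : represents env' n.+2 vs Z.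
      by apply: updT_other => //; apply: updT_represents.
    have repW : represents env' n.+3 (y :: vs) W := updT_represents _ _ _ Uyvs Dyvs.
    cbn [ssat]; rewrite (ssat_mixture (updv sg a c) Uyvs Dvs a_yvs repX repY repZ repW).
    rewrite updvE -(IHp n.+1 vs D Y env' (updv sg a c)) //.
    by rewrite -(IHq n.+2 vs D Z env' (updv sg a c)).
  have exists_teams c : ssat I (updv sg a c) env (SExF (n.+1, size vs)
      (SExF (n.+2, size vs) (SExF (n.+3, size (y :: vs))
        (SAnd (mixture ar n vs y a) (SAnd (tr n.+1 vs p) (tr n.+2 vs q))))))
      <-> exists Y, is_prob Y /\ exists Z, is_prob Z /\
            exists W : team A (y |` D), is_prob W /\
              (is_mixture c X Y Z W /\ (sat I p Y /\ sat I q Z)).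
    rewrite (ssat_exists_team _ _ _ _ Uvs Dvs).
    split=> -[Y [Yp]]; [rewrite (ssat_exists_team _ _ _ _ Uvs Dvs)|];
      move=> [Z [Zp]]; [rewrite (ssat_exists_team _ _ _ _ Uyvs Dyvs)|];
      move=> [W [Wp H]]; exists Y; split=> //.
      by exists Z; split=> //; exists W; split=> //; apply/body.
    rewrite (ssat_exists_team _ _ _ _ Uvs Dvs); exists Z; split=> //.
    rewrite (ssat_exists_team _ _ _ _ Uyvs Dyvs); exists W; split=> //.
    exact/body.
  by split=> -[c H]; exists c; apply/(exists_teams c).
- have Uxvs := requant_uniq x Uvs; have Dxvs := fsetU1_requant x Dvs.
  cbn [tr sat]; rewrite (exists_supdP sg _ Uvs Dvs Xp).
  rewrite (ssat_exists_team _ _ _ _ Uxvs Dxvs).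
  have body (Y : team A (x |` D)) : is_prob Y ->
      ssat I sg (updT env n.+1 (requant x vs) Y)
        (SAnd (same_marg ar n vs x) (tr n.+1 (requant x vs) p))
      <-> marginal_of vs X Y /\ sat I p Y.
    move=> Yp; set env' := updT _ _ _ _.
    have repX : represents env' n vs X by apply: updT_other rep; rewrite gtn_eqF.
    have repY : represents env' n.+1 (requant x vs) Y :=
      updT_represents _ _ _ Uxvs Dxvs.
    cbn [ssat]; rewrite (ssat_same_marg _ Uvs Dvs repX repY).
    by rewrite -(IH n.+1 (requant x vs) _ Y env' sg) //; apply: fv_requant.
  by split=> -[Y [Yp H]]; exists Y; split=> //; apply/body.
- have Uxvs := requant_uniq x Uvs; have Dxvs := fsetU1_requant x Dvs.
  cbn [tr sat]; rewrite (supd_uniformP sg (sat I p (D := x |` D)) Uvs Dvs Xp).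
  rewrite (ssat_exists_team _ _ _ _ Uxvs Dxvs).
  have body (Y : team A (x |` D)) : is_prob Y ->
      ssat I sg (updT env n.+1 (requant x vs) Y)
        (SAnd (same_marg ar n vs x)
          (SAnd (uniform_in ar n.+1 vs x) (tr n.+1 (requant x vs) p)))
      <-> marginal_of vs X Y /\
          ((forall tau c, Y (restr _ tau) = Y (restr _ (updv tau x c))) /\ sat I p Y).
    move=> Yp; set env' := updT _ _ _ _.
    have repX : represents env' n vs X by apply: updT_other rep; rewrite gtn_eqF.
    have repY : represents env' n.+1 (requant x vs) Y :=
      updT_represents _ _ _ Uxvs Dxvs.
    cbn [ssat]; rewrite (ssat_same_marg _ Uvs Dvs repX repY).
    rewrite (ssat_uniform_in _ Uvs Dvs repY).
    by rewrite -(IH n.+1 (requant x vs) _ Y env' sg) //; apply: fv_requant.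
  by split=> -[Y [Yp H]]; exists Y; split=> //; apply/body.
Qed.

End Correctness.

Theorem mainTheorem4 (Sym : finType) (ar : Sym -> nat) (phi : foform ar) (vs : seq nat) :
  uniq vs -> {subset fv phi <= vs} ->
  exists psi : soform ar,
    [/\ sfv psi = [::],
        (forall h, h \in sffv psi <-> h = (O, size vs)) &
        forall (A : finType) (I : forall r : Sym, {set (ar r).-tuple A}),
          (0 < #|A|)%nat ->
          forall X : team A (dom_of vs), is_prob X ->
          forall sigma : nat -> A,
            sat I phi X <-> ssat I sigma (envX X) psi].
Proof.
move=> Uvs sub; exists (tr 0 vs phi); split.
- by apply/eqP; rewrite -size_eq0 -leqn0 leqNgt -has_predT; apply/hasPn => v; rewrite sfv_tr.
- by move=> h; rewrite sffv_tr; split=> [/eqP|->].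
- have Dvs : dom_of vs =i vs by move=> v; rewrite /dom_of !inE.
  move=> A I _ X Xp sg; apply: ssat_tr => // tau.
  (* The given distribution is the mass of a full tuple of values, that is, the weight of one
     assignment. *)
  by rewrite /envX eqxx /fX -/(mass X vs _) mass_all.
Qed.
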